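(* Let $G$ be a group with identity $e$ and let $R=\bigoplus_{g\in G}R_g$ be a $G$-graded commutative ring with identity, of finite support. Assume that $1=u+v$ for some $u,v\in U(R_e)$. If $R$ is graded nil-good, then $M_2(R)(\overline{\sigma})$ is graded nil-good, where $\overline{\sigma}=(e,e)$.
   Context: A ring $R$ is $G$-graded if $R=\bigoplus_{g\in G}R_g$ with $R_g$ additive subgroups and $R_gR_h\subseteq R_{gh}$ for all $g,h\in G$; elements of the components are called homogeneous. The support of $R$ is $\{g\in G:R_g\ne0\}$. $U(S)$ denotes the group of units of a ring $S$. For $\overline{\sigma}=(g_1,\dots,g_n)\in G^n$, $M_n(R)(\overline{\sigma})$ denotes the matrix ring $M_n(R)$ with the $G$-grading whose component of degree $\lambda\in G$ consists of the matrices $(a_{ij})$ with $a_{ij}\in R_{g_i\lambda g_j^{-1}}$; for $\overline{\sigma}=(e,\dots,e)$ this component is the set of matrices with all entries in $R_\lambda$. A $G$-graded ring is graded nil-good if each of its homogeneous elements is either nilpotent or a sum of a homogeneous unit and a homogeneous nilpotent. *)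

(* Defs.v *)
From HB Require Import structures.
From mathcomp Require Import all_boot all_order all_algebra.

Set Implicit Arguments.
Unset Strict Implicit.
Unset Printing Implicit Defensive.

Import GRing.Theory.
Local Open Scope ring_scope.

(* [pzRingType] (rather than [nzRingType]) does not impose 1 != 0. *)
Record grading (G : groupType) (S : pzRingType) := Grading {
  component :> G -> S -> Prop;
  component0 : forall g, component g 0;
  componentB : forall g x y,
    component g x -> component g y -> component g (x - y);
  componentM : forall g h x y,
    component g x -> component h y -> component (g * h)%g (x * y);
  (* S is the sum of the components *)
  component_span : forall x : S, exists s : seq S,
    (forall y, y \in s -> exists g, component g y) /\ x = \sum_(y <- s) y;
  (* and this sum is direct *)
  component_indep : forall (s : seq G) (f : G -> S), uniq s ->
    (forall g, g \in s -> component g (f g)) ->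
    \sum_(g <- s) f g = 0 -> forall g, g \in s -> f g = 0
}.

Definition homogeneous (G : groupType) (S : pzRingType) (A : grading G S)
  (x : S) : Prop := exists g, A g x.

Definition in_support (G : groupType) (S : pzRingType) (A : grading G S)
  (g : G) : Prop := exists2 x : S, A g x & x <> 0.

Definition finite_support (G : groupType) (S : pzRingType) (A : grading G S)
  : Prop := exists s : seq G, forall g, in_support A g -> g \in s.

(* Invertibility is stated directly because the library's [GRing.unit] requires
   a nontrivial ring with a decidable set of units. *)
Definition is_unit (S : pzRingType) (x : S) : Prop :=
  exists y, x * y = 1 /\ y * x = 1.

(* U(S_e): the inverse is required to lie in S_e. *)
Definition identity_component_unit (G : groupType) (S : pzRingType)
  (A : grading G S) (x : S) : Prop :=
  A 1%g x /\ exists y, [/\ A 1%g y, x * y = 1 & y * x = 1].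

Definition is_nilpotent (S : pzRingType) (x : S) : Prop :=
  exists n : nat, x ^+ n = 0.

Definition graded_nil_good (G : groupType) (S : pzRingType) (A : grading G S)
  : Prop :=
  forall x : S, homogeneous A x ->
    is_nilpotent x \/
    exists u v : S, [/\ homogeneous A u, is_unit u,
                        homogeneous A v, is_nilpotent v & x = u + v].

Definition mx_component (G : groupType) (S : pzRingType) (A : grading G S)
  (n : nat) (sigma : n.-tuple G) (lambda : G) (M : 'M[S]_n) : Prop :=
  forall i j, A (tnth sigma i * lambda * (tnth sigma j)^-1)%g (M i j).

Section MatrixGrading.
Variables (G : groupType) (S : pzRingType) (A : grading G S).
Variables (n : nat) (sigma : n.-tuple G).

Lemma componentD g x y : A g x -> A g y -> A g (x + y).
Proof.
move=> Ax Ay; rewrite -[y]opprK; apply: componentB => //.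
by rewrite -[- y]add0r; apply: componentB => //; apply: component0.
Qed.

Lemma mx_component0 lambda : mx_component A sigma lambda 0.
Proof. by move=> i j; rewrite mxE; apply: component0. Qed.

Lemma mx_componentB lambda M N : mx_component A sigma lambda M ->
  mx_component A sigma lambda N -> mx_component A sigma lambda (M - N).
Proof. by move=> AM AN i j; rewrite !mxE; apply: componentB. Qed.

Lemma mx_componentM lambda mu M N : mx_component A sigma lambda M ->
  mx_component A sigma mu N -> mx_component A sigma (lambda * mu)%g (M * N).
Proof.
move=> AM AN i j; rewrite mxE.
apply: (big_ind (A _)) => [|x y|k _]; [exact: component0|exact: componentD|].
have := componentM (AM i k) (AN k j).
by rewrite !mulgA mulgVK.
Qed.

Lemma mx_component_span M : exists s : seq 'M[S]_n,
  (forall N, N \in s -> exists g, mx_component A sigma g N)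
  /\ M = \sum_(N <- s) N.
Proof.
pose P M := exists s : seq 'M[S]_n,
  (forall N, N \in s -> exists g, mx_component A sigma g N)
  /\ M = \sum_(N <- s) N.
have P0 : P 0 by exists [::]; rewrite big_nil.
have PD M1 M2 : P M1 -> P M2 -> P (M1 + M2).
  move=> [s1 [h1 ->]] [s2 [h2 ->]]; exists (s1 ++ s2); rewrite big_cat.
  by split=> // N; rewrite mem_cat => /orP[/h1|/h2].
rewrite -/(P M) [M]matrix_sum_delta.
apply: (big_ind P) => // i _; apply: (big_ind P) => // j _.
have [s [hs ->]] := component_span A (M i j).
rewrite scaler_suml big_seq; apply: (big_ind P) => // x /hs[g Ax].
exists [:: x *: delta_mx i j]; rewrite big_seq1; split=> // N.
rewrite inE => /eqP->; exists ((tnth sigma i)^-1 * g * tnth sigma j)%g => a b.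
rewrite !mxE; case: eqP => [->|_]; last by rewrite mulr0; apply: component0.
case: eqP => [->|_]; last by rewrite mulr0; apply: component0.
by rewrite mulr1 !mulgA mulgV mul1g mulgK.
Qed.

Lemma mx_component_indep (s : seq G) (f : G -> 'M[S]_n) : uniq s ->
  (forall g, g \in s -> mx_component A sigma g (f g)) ->
  \sum_(g <- s) f g = 0 -> forall g, g \in s -> f g = 0.
Proof.
move=> us Af sum0 g gs; apply/matrixP => i j; rewrite mxE.
pose t h := (tnth sigma i * h * (tnth sigma j)^-1)%g.
pose t' h := ((tnth sigma i)^-1 * h * tnth sigma j)%g.
have tK : cancel t t' by move=> h; rewrite /t /t' !mulgA mulVg mul1g mulgVK.
rewrite -(tK g).
apply: (@component_indep _ _ A (map t s) (fun h => f (t' h) i j)).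
- by rewrite map_inj_uniq //; apply: can_inj tK.
- by move=> _ /mapP[h hs ->]; rewrite tK; apply: Af.
- rewrite big_map; under eq_bigr do rewrite tK.
  by rewrite -(summxE _ _ _ i j) sum0 mxE.
- exact: map_f.
Qed.

(* M_n(S)(sigma) *)
Definition mx_grading : grading G 'M[S]_n :=
  Grading mx_component0 mx_componentB mx_componentM
    mx_component_span mx_component_indep.

End MatrixGrading.

(* Main.v *)
Require Import Defs.
From mathcomp Require Import all_boot all_order all_algebra.
From mathcomp Require Import ring.

(** Write M = [[a, b], [c, d]] for a homogeneous matrix of degree g; since
    sigma = (e, e), its four entries all lie in R_g.

    In a commutative ring a unit plus a nilpotent is a unit, so every
    homogeneous element of a commutative graded nil-good ring is either a unit
    or nilpotent.  In particular det M, which is homogeneous of degree g * g, is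
    a unit, in which case so is M, or nilpotent.

    Suppose det M is nilpotent.  For a traceless matrix N of determinant 0,
      det (M - N) = det M + tr (M N),
    and N * N = 0 by Cayley-Hamilton.  So M = (M - N) + N is a decomposition of
    the required kind as soon as the entries of N lie in R_g and tr (M N) is a
    unit ([nil_good_of_unit_trace]).  Testing against
      N = [[0, c], [0, 0]],   [[0, 0], [b, 0]],   [[s, s], [-s, -s]]
    with s = a - d gives tr (M N) = c^2, b^2 and s * (s + c - b).  Hence M is
    decomposable if one of c, b, a - d is a unit.  Otherwise all three are
    nilpotent, hence so are a^2 = a (a - d) + det M + b c, then a, d and tr M;
    and a matrix with nilpotent trace and determinant is nilpotent, again by
    Cayley-Hamilton ([mx22_nilpotent]). *)

Import GRing.Theory.

Local Open Scope ring_scope.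

Set Implicit Arguments.
Unset Strict Implicit.

(** In each term of the binomial expansion of (x + y)^(m + n), either x has
    exponent at least m or y has exponent at least n. *)
Lemma nilpotentD_comm (S : pzRingType) (x y : S) : GRing.comm x y ->
  is_nilpotent x -> is_nilpotent y -> is_nilpotent (x + y).
Proof.
move=> cxy [m xm0] [n yn0]; exists (m + n)%N; rewrite exprDn_comm //.
apply: big1 => i _; case: (leqP n i) => [le_ni | lt_in].
  by rewrite -(subnKC le_ni) (exprD y) yn0 mul0r mulr0 mul0rn.
have le_m : (m <= m + n - i)%N by rewrite -addnBA ?leq_addr // ltnW.
by rewrite -(subnKC le_m) exprD xm0 !mul0r mul0rn.
Qed.

Lemma nilpotentM_comm (S : pzRingType) (x y : S) : GRing.comm x y ->
  is_nilpotent x -> is_nilpotent (x * y).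
Proof. by move=> cxy [n xn0]; exists n; rewrite exprMn_comm // xn0 mul0r. Qed.

Lemma nilpotent_sqr (S : pzRingType) (x : S) :
  is_nilpotent (x ^+ 2) -> is_nilpotent x.
Proof. by case=> n; rewrite -exprM => x0; exists (2 * n)%N. Qed.

Section Commutative.
Variable R : comPzRingType.
Implicit Types (x y u v : R).

Lemma nilpotentD x y : is_nilpotent x -> is_nilpotent y -> is_nilpotent (x + y).
Proof. by apply: nilpotentD_comm; apply: mulrC. Qed.

Lemma nilpotentM x y : is_nilpotent x -> is_nilpotent (x * y).
Proof. by apply: nilpotentM_comm; apply: mulrC. Qed.

Lemma nilpotentN x : is_nilpotent x -> is_nilpotent (- x).
Proof. by rewrite -mulrN1; apply: nilpotentM. Qed.

Lemma unitM x y : is_unit x -> is_unit y -> is_unit (x * y).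
Proof.
move=> [x' [xx' _]] [y' [yy' _]]; exists (x' * y').
by split; rewrite 1?[_ * (x * y)]mulrC mulrACA xx' yy' mulr1.
Qed.

(** If v^n = 0, then u + v divides u^n - (-v)^n = u^n. *)
Lemma unitD_nilpotent u v : is_unit u -> is_nilpotent v -> is_unit (u + v).
Proof.
move=> [w [uw1 _]] [n vn0].
have := subrXX u (- v) n; rewrite exprNn vn0 mulr0 subr0 opprK.
set s := \sum_(_ < _) _ => uE.
have uvK : (u + v) * (s * w ^+ n) = 1 by rewrite mulrA -uE -exprMn uw1 expr1n.
by exists (s * w ^+ n); rewrite [_ * (u + v)]mulrC uvK.
Qed.

(** The adjugate provides the inverse. *)
Lemma mx_unit_of_det n (M : 'M[R]_n) : is_unit (\det M) -> is_unit M.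
Proof.
move=> [d [dK _]]; exists (d%:M *m \adj M); split.
  by rewrite -[LHS]/(M *m _) -scalar_mxC mulmxA mul_mx_adj -scalar_mxM dK.
by rewrite -[LHS]/(_ *m M) -mulmxA mul_adj_mx -scalar_mxM mulrC dK.
Qed.

Definition mx22 x y z t : 'M[R]_2 :=
  \matrix_(i, j) if i == 0 then (if j == 0 then x else y)
                 else (if j == 0 then z else t).

Lemma mx22_eta (M : 'M[R]_2) : M = mx22 (M 0 0) (M 0 1) (M 1 0) (M 1 1).
Proof.
apply/matrixP=> i j; rewrite mxE.
by case: i => [[|[|]]] //= ?; case: j => [[|[|]]] //= ?;
   congr (M _ _); apply: val_inj.
Qed.

Lemma trace_mx22 x y z t : \tr (mx22 x y z t) = x + t.
Proof. by rewrite /mxtrace !big_ord_recl big_ord0 !mxE addr0. Qed.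

Lemma det_mx22 x y z t : \det (mx22 x y z t) = x * t - y * z.
Proof.
rewrite (expand_det_row _ 0) !big_ord_recl big_ord0 /cofactor !det_mx11.
rewrite !mxE /= !mulrA; ring.
Qed.

Lemma mul_mx22 x y z t x' y' z' t' :
  mx22 x y z t *m mx22 x' y' z' t' =
  mx22 (x * x' + y * z') (x * y' + y * t') (z * x' + t * z') (z * y' + t * t').
Proof.
apply/matrixP=> i j; rewrite !mxE !big_ord_recl big_ord0 !mxE /= addr0.
by case: (i == 0); case: (j == 0).
Qed.

Lemma sub_mx22 x y z t x' y' z' t' :
  mx22 x y z t - mx22 x' y' z' t' = mx22 (x - x') (y - y') (z - z') (t - t').
Proof.
by apply/matrixP=> i j; rewrite !mxE; case: (i == 0); case: (j == 0).
Qed.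

Lemma Cayley_Hamilton22 (M : 'M[R]_2) :
  M ^+ 2 = M * (\tr M)%:M + (- \det M)%:M.
Proof.
rewrite [M]mx22_eta; move: (M 0 0) (M 0 1) (M 1 0) (M 1 1) => a b c d.
have scalE x : x%:M = mx22 x 0 0 x.
  by apply/matrixP=> i j; rewrite !mxE; case: i => [[|[|]]] //= ?;
     case: j => [[|[|]]].
rewrite !scalE -[_ * mx22 _ _ _ _]/(_ *m _) -[_ ^+ 2]/(_ *m _) !mul_mx22.
rewrite trace_mx22 det_mx22.
apply/matrixP=> i j; rewrite !mxE.
by case: (i == 0); case: (j == 0); ring.
Qed.

Lemma det_sub_traceless (M N : 'M[R]_2) : \tr N = 0 -> \det N = 0 ->
  \det (M - N) = \det M + \tr (M *m N).
Proof.
rewrite [M]mx22_eta [N]mx22_eta.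
move: (M 0 0) (M 0 1) (M 1 0) (M 1 1) => a b c d.
move: (N 0 0) (N 0 1) (N 1 0) (N 1 1) => x y z t.
rewrite sub_mx22 mul_mx22 !trace_mx22 !det_mx22 => /(canRL (addrK _)).
rewrite sub0r => -> N0.
transitivity (a * d - b * c + (a * - t + b * z + (c * y + d * t))
              + (- t * t - y * z)); first ring.
by rewrite N0 addr0.
Qed.

(** By Cayley-Hamilton, M^2 is a sum of two commuting nilpotents. *)
Lemma mx22_nilpotent (M : 'M[R]_2) :
  is_nilpotent (\tr M) -> is_nilpotent (\det M) -> is_nilpotent M.
Proof.
have scal_nil x : is_nilpotent x -> is_nilpotent (x%:M : 'M[R]_2).
  case=> n x0; exists n.
  by rewrite -(rmorphXn (@scalar_mx R 2)) x0 raddf0.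
move=> trM detM; apply: nilpotent_sqr; rewrite Cayley_Hamilton22.
have cM x (N : 'M[R]_2) : GRing.comm N x%:M by apply: comm_mx_scalar.
apply: nilpotentD_comm; first exact: cM.
  by rewrite cM; exact: nilpotentM_comm (commr_sym (cM _ _)) (scal_nil _ trM).
exact/scal_nil/nilpotentN.
Qed.

End Commutative.

Section GradedNilGood.
Variables (G : groupType) (R : comPzRingType) (A : grading G R).
Hypothesis nilgoodA : graded_nil_good A.

(** If x is not nilpotent, it is a unit plus a nilpotent, hence a unit by
    [unitD_nilpotent]. *)
Lemma homogeneous_nilpotent_or_unit g x :
  A g x -> is_nilpotent x \/ is_unit x.
Proof.
move=> Ax; have [nx | [u [v [_ uu _ nv ->]]]] := nilgoodA (ex_intro _ g Ax).
  by left.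
by right; apply: unitD_nilpotent.
Qed.

Lemma mx_component_e g (M : 'M[R]_2) :
  mx_component A [tuple 1%g; 1%g] g M <-> forall i j, A g (M i j).
Proof.
have e1 i : tnth [tuple 1%g; 1%g] i = 1%g :> G.
  by case: i => [[|[|]]] //= lt_i; rewrite (tnth_nth 1%g).
by split=> AM i j; have := AM i j; rewrite !e1 mul1g invg1 mulg1.
Qed.

Lemma mx22_homogeneous g a b c d : A g a -> A g b -> A g c -> A g d ->
  mx_component A [tuple 1%g; 1%g] g (mx22 a b c d).
Proof.
move=> Aa Ab Ac Ad; apply/mx_component_e=> i j; rewrite mxE.
by case: (i == 0); case: (j == 0).
Qed.

(** The decomposition is M = (M - N) + N: the determinant of M - N is the
    nilpotent det M plus the unit tr (M N), hence a unit. *)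
Lemma nil_good_of_unit_trace g (M N : 'M[R]_2) :
  mx_component A [tuple 1%g; 1%g] g M -> mx_component A [tuple 1%g; 1%g] g N ->
  is_nilpotent (\det M) -> \tr N = 0 -> \det N = 0 -> is_unit (\tr (M *m N)) ->
  exists U V : 'M[R]_2,
    [/\ homogeneous (mx_grading A [tuple 1%g; 1%g]) U, is_unit U,
        homogeneous (mx_grading A [tuple 1%g; 1%g]) V, is_nilpotent V
      & M = U + V].
Proof.
move=> AM AN nilM trN detN uMN; exists (M - N), N; split.
- by exists g; apply: mx_componentB.
- apply: mx_unit_of_det; rewrite det_sub_traceless // addrC.
  exact: unitD_nilpotent.
- by exists g.
- by apply: mx22_nilpotent; rewrite ?trN ?detN; exists 1%N; rewrite expr1.
- by rewrite subrK.
Qed.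

End GradedNilGood.

Theorem theorem4p5 (G : groupType) (R : comPzRingType) (A : grading G R)
  (hsupp : finite_support A)
  (hunits : exists u v : R,
    [/\ identity_component_unit A u, identity_component_unit A v
      & 1 = u + v])
  (hnilgood : graded_nil_good A) :
  graded_nil_good (mx_grading A [tuple 1%g; 1%g]).
Proof.
move=> M [g AM]; move: (AM : mx_component A [tuple 1%g; 1%g] g M) => {}AM.
have AMe := (mx_component_e A g M).1 AM.
have := (AMe 1 1, AMe 1 0, AMe 0 1, AMe 0 0); move: AM {AMe}.
rewrite [M]mx22_eta; move: (M 0 0) (M 0 1) (M 1 0) (M 1 1) => a b c d.
rewrite !mxE /= => AM [[[Ad Ac] Ab] Aa].
have A0 := component0 A g; have As := componentB Aa Ad.
have AN x : A g x -> A g (- x) by rewrite -sub0r; apply: componentB.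
have Adet : A (g * g)%g (\det (mx22 a b c d)).
  by rewrite det_mx22; apply: componentB; apply: componentM.
have [ndet | udet] := homogeneous_nilpotent_or_unit hnilgood Adet; last first.
  right; exists (mx22 a b c d), 0; split.
  - by exists g.
  - exact: mx_unit_of_det.
  - by exists g; apply: mx_component0.
  - by exists 1%N; rewrite expr1.
  - by rewrite addr0.
have [nc | uc] := homogeneous_nilpotent_or_unit hnilgood Ac; last first.
  right; apply: (nil_good_of_unit_trace AM (mx22_homogeneous A0 Ac A0 A0)) => //.
  - by rewrite trace_mx22 addr0.
  - by rewrite det_mx22; ring.
  - rewrite mul_mx22 trace_mx22 !mulr0 !add0r addr0.
    exact: unitM.
have [nb | ub] := homogeneous_nilpotent_or_unit hnilgood Ab; last first.
  right; apply: (nil_good_of_unit_trace AM (mx22_homogeneous A0 A0 Ab A0)) => //.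
  - by rewrite trace_mx22 addr0.
  - by rewrite det_mx22; ring.
  - rewrite mul_mx22 trace_mx22 !mulr0 !add0r addr0.
    exact: unitM.
(* For s = a - d and N = [[s, s], [-s, -s]], the nilpotents b and c enter
   tr (M N) only by perturbing one factor of the unit s * s. *)
have [ns | us] := homogeneous_nilpotent_or_unit hnilgood As; last first.
  right; apply: (nil_good_of_unit_trace AM
    (mx22_homogeneous As As (AN _ As) (AN _ As))) => //.
  - by rewrite trace_mx22 subrr.
  - by rewrite det_mx22; ring.
  - rewrite mul_mx22 trace_mx22.
    have -> : a * (a - d) + b * - (a - d) + (c * (a - d) + d * - (a - d))
              = (a - d) * ((a - d) + (c - b)) by ring.
    by apply/unitM/unitD_nilpotent/nilpotentD/nilpotentN.
(* There remains the case where b, c, a - d and det M are all nilpotent. *)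
left; apply: mx22_nilpotent => //.
have na : is_nilpotent a.
  apply: nilpotent_sqr.
  have -> : a ^+ 2 = (a - d) * a + \det (mx22 a b c d) + b * c.
    by rewrite det_mx22; ring.
  by do 2?apply: nilpotentD => //; apply: nilpotentM.
rewrite trace_mx22; apply: nilpotentD => //.
by rewrite -[d](subKr a); apply: nilpotentD => //; apply: nilpotentN.
Qed.
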